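(* Let $\mathcal{Z}$ be a measurable space, $d:\mathcal{Z}\times\mathcal{Z}\to[0,\infty]$ a measurable function with $d(z,z)=0$ for all $z$, $\bm{l}:\mathcal{Z}\times\Theta\to\mathbb{R}$ a loss function, $\mathcal{Z}_N=\{Z^{(1)},\dots,Z^{(N)}\}\subset\mathcal{Z}$, $\mu_i=\frac1N$ for all $i$, and $\epsilon>0$. Put $\mathcal{L}=\{\bm{l}(\cdot;\theta):\theta\in\Theta\}$, $\tilde{\mathcal{L}}_\epsilon=\{\tilde{\bm{l}}_\epsilon(\cdot;\theta):\theta\in\Theta\}$ with $\tilde{\bm{l}}_\epsilon(z;\theta)=\sup_{z':d(z',z)\le\epsilon}\bm{l}(z';\theta)$, and $\Upsilon_\epsilon=\{z\mapsto\Delta_\theta(z,\epsilon):\theta\in\Theta\}$. Then $$\big|\hat{\mathfrak{R}}_{\mathcal{Z}_N}(\tilde{\mathcal{L}}_\epsilon)-\hat{\mathfrak{R}}_{\mathcal{Z}_N}(\mathcal{L})\big|\le\hat{\mathfrak{R}}_{\mathcal{Z}_N}(\Upsilon_\epsilon)\le\sup_{\theta\in\Theta}\sum_{i=1}^N\frac1N\Delta_\theta(Z^{(i)},\epsilon).$$ In addition, if $\Delta_\theta(z,\epsilon)=\Delta_\theta^{\max}(\epsilon)$ for every $z\in\mathcal{Z}_N$ (and $\theta\in\Theta$), then the last term can be replaced by the bound $\frac{1}{\sqrt N}\sup_{\theta\in\Theta}\Delta_\theta^{\max}(\epsilon)$. Furthermore, for every $t>0$, $$0\le\hat{\mathfr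ak{C}}_{\mathcal{Z}_N}(\tilde{\mathcal{L}}_\epsilon,t)\le\hat{\mathfrak{C}}_{\mathcal{Z}_N}(\mathcal{L},t)+\hat{\mathfrak{C}}_{\mathcal{Z}_N}(\Upsilon_\epsilon,t).$$
   Context: Rates: $\Delta_\theta(z,t)=\sup_{z'\in\mathcal{Z}}\{\bm{l}(z';\theta)-\bm{l}(z;\theta):d(z',z)\le t\}$ and $\Delta_\theta^{\max}(t)=\max_{Z^{(i)}\in\mathcal{Z}_N}\Delta_\theta(Z^{(i)},t)$. It is understood that $\Delta_\theta(z,\epsilon)<\infty$ for all $z\in\mathcal{Z}$, $\theta\in\Theta$ (so the functions in $\tilde{\mathcal{L}}_\epsilon$ and $\Upsilon_\epsilon$ are real-valued), and that $\hat{\mathfrak{R}}_{\mathcal{Z}_N}(\tilde{\mathcal{L}}_\epsilon),\hat{\mathfrak{R}}_{\mathcal{Z}_N}(\mathcal{L})$ are finite when their difference is considered. Empirical Rademacher complexity of a class $\mathcal{G}$ of functions $g:\mathcal{Z}\to\mathbb{R}$: $\hat{\mathfrak{R}}_{\mathcal{Z}_N}(\mathcal{G})=\mathbb{E}_\sigma\big[\sup_{g\in\mathcal{G}}\frac1N\sum_{i=1}^N\sigma_i g(Z^{(i)})\big]$, with $\sigma_1,\dots,\sigma_N$ independent and uniform on $\{-1,+1\}$. Concave complexity of a class $\mathcal{G}$ of functions $g:\mathcal{Z}\to\mathbb{R}$: $\hat{\mathfrak{C}}_{\mathcal{Z}_N}(\mathcal{G},t)=\sup_{g\in\mathcal{G}}\mathcal{C}_{\Delta_g^{\max}}(t)\in[0,\infty]$,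 where $\Delta_g^{\max}(t)=\max_{Z^{(i)}\in\mathcal{Z}_N}\sup_{z'\in\mathcal{Z}}\{g(z')-g(Z^{(i)}):d(z',Z^{(i)})\le t\}$ and, for a nonnegative (possibly $+\infty$-valued) $f$ on $[0,\infty)$, $\mathcal{C}_f(t)=\inf\{H(t):H\ge f,\ H\text{ concave on }[0,\infty)\}$ is its least concave majorant ($H$ may take the value $+\infty$, and is concave if its hypograph is convex). *)

(* Defs.v *)
From mathcomp Require Import all_boot all_order all_algebra.
From mathcomp Require Import all_classical all_reals all_analysis.

Set Implicit Arguments.
Unset Strict Implicit.
Unset Printing Implicit Defensive.

Import Order.TTheory GRing.Theory Num.Theory.
Import numFieldNormedType.Exports.

Local Open Scope classical_set_scope.
Local Open Scope ring_scope.

Section concave_majorant.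
Variable R : realType.
Implicit Types f H : R -> \bar R.

(* The domain of the functions below is [0, +oo[; values at negative arguments
   are junk and never looked at. *)
Definition hypograph H : set (convex_lmodType (R^o * R^o)%type) :=
  [set p | 0 <= p.1 /\ (p.2%:E <= H p.1)%E].

Definition concave_on_nneg H := convex_set (hypograph H).

Definition concave_majorant f : set (R -> \bar R) :=
  [set H | (forall s : R, 0 <= s -> (f s <= H s)%E) /\ concave_on_nneg H].

Definition least_concave_majorant f (t : R) : \bar R :=
  ereal_inf [set H t | H in concave_majorant f].

End concave_majorant.

Section complexities.
Variables (R : realType) (T : Type) (cost : T * T -> \bar R).
Variables (N : nat) (Z : 'I_N -> T).
Implicit Types (g : T -> R) (G : set (T -> R)) (z : T) (t : R).

Definition rate g z t : \bar R :=
  ereal_sup [set (g z' - g z)%:E | z' in [set z' | (cost (z', z) <= t%:E)%E]].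

(* Meaningful for 0 < N, where it is the maximum over the sample. *)
Definition rate_max g t : \bar R :=
  \big[maxe/-oo%E]_(i < N) rate g (Z i) t.

(* N independent uniform signs are a uniformly distributed element of
   {-1,+1}^N, encoded by s : {ffun 'I_N -> bool} with signs (-1) ^+ s i; the
   expectation is the sum over the 2 ^ N atoms, each of mass 2 ^- N. *)
Definition rademacher G : \bar R :=
  (\sum_(s : {ffun 'I_N -> bool}) (2 ^- N)%:E *
     ereal_sup [set (N%:R^-1 * \sum_(i < N) (-1) ^+ s i * g (Z i))%R%:E
               | g in G])%E.

Definition concave_complexity G t : \bar R :=
  ereal_sup [set least_concave_majorant (rate_max g) t | g in G].

End complexities.

Section loss_classes.
Variables (R : realType) (T Theta : Type) (cost : T * T -> \bar R).
Variables (l : T -> Theta -> R) (eps : R).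

(* In this section fine only casts a supremum to R; nothing is lost as soon as
   every rate (l^~ theta) z eps is finite. *)
Definition robust_loss (z : T) (theta : Theta) : R :=
  fine (ereal_sup [set (l z' theta)%:E
                  | z' in [set z' | (cost (z', z) <= eps%:E)%E]]).

Definition loss_class : set (T -> R) :=
  range (fun (theta : Theta) (z : T) => l z theta).

Definition robust_class : set (T -> R) :=
  range (fun (theta : Theta) (z : T) => robust_loss z theta).

Definition rate_class : set (T -> R) :=
  range (fun (theta : Theta) (z : T) => fine (rate cost (l^~ theta) z eps)).

End loss_classes.

(* Main.v *)
(* The robust loss is the loss plus its rate, pointwise.  Suprema are
   subadditive and the law of the signs is symmetric, so both complexities
   inherit subadditivity: for the concave one because a sum of nonnegative
   concave majorants is a concave majorant of the sum.  When the rate is constant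
   on the sample it factors out of the signed sum, leaving E|sum of N signs|,
   which is at most sqrt N since its square averages to N. *)
Require Import Defs.
From mathcomp Require Import all_boot all_order all_algebra.
From mathcomp Require Import all_classical all_reals all_analysis.
From mathcomp Require Import measurable_realfun.
From mathcomp Require Import ring lra.
Import Order.TTheory GRing.Theory Num.Theory.
Import numFieldNormedType.Exports.
Local Open Scope classical_set_scope.
Local Open Scope ring_scope.


Set Implicit Arguments.
Unset Strict Implicit.
Unset Printing Implicit Defensive.

(** * Moments of a sum of independent signs *)

Section signs.
Variables (R : realType) (N : nat).
Implicit Types s : {ffun 'I_N -> bool}.

Lemma ereal_sum_signsN (F : {ffun 'I_N -> bool} -> \bar R) :
  (\sum_(s : {ffun 'I_N -> bool}) F [ffun i => ~~ s i] = \sum_s F s)%E.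
Proof.
have negK : involutive (fun s => [ffun i => ~~ s i]).
  by move=> s; apply/ffunP => i; rewrite !ffunE negbK.
by rewrite [RHS](reindex_inj (inv_inj negK)).
Qed.

Lemma sum_signs_const (x : R) :
  \sum_(s : {ffun 'I_N -> bool}) x = 2 ^+ N * x.
Proof.
by rewrite sumr_const card_ffun card_bool card_ord -natrX mulr_natl.
Qed.

(** The atoms have total mass one. A constant bound, even an infinite one, can thus be spread over
    the sign patterns and compared atom by atom. *)
Lemma ereal_mean_signs (c : \bar R) :
  (\sum_(s : {ffun 'I_N -> bool}) (2 ^- N)%:E * c = c)%E.
Proof.
rewrite -ge0_sume_distrl; last by move=> s _; rewrite lee_fin invr_ge0 exprn_ge0.
by rewrite sumEFin sum_signs_const mulfV ?mul1e// expf_neq0.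
Qed.

(** Flipping the sign at [i] alone permutes the patterns and negates every summand, so the sum
    equals its own opposite. *)
Lemma sum_signs_indep (i j : 'I_N) : i != j ->
  \sum_(s : {ffun 'I_N -> bool}) (-1) ^+ s i * (-1) ^+ s j = 0 :> R.
Proof.
move=> ij.
pose flip s : {ffun 'I_N -> bool} := [ffun k => (k == i) (+) s k].
have flipK : involutive flip.
  by move=> s; apply/ffunP => k; rewrite !ffunE addbA addbb.
set S := LHS; suff : S = - S by lra.
rewrite {1}/S (reindex_inj (inv_inj flipK)) -sumrN; apply: eq_bigr => s _.
by rewrite !ffunE eqxx eq_sym (negbTE ij) addTb addFb signrN mulNr.
Qed.

(** In the expanded square the off-diagonal products cancel in the sum, while each of the [N]
    diagonal ones equals 1 on every pattern. *)
Lemma sum_signs_sqr :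
  \sum_(s : {ffun 'I_N -> bool}) (\sum_(i < N) (-1) ^+ s i) ^+ 2
    = 2 ^+ N * N%:R :> R.
Proof.
under eq_bigr do rewrite expr2 big_distrlr.
rewrite exchange_big/= (eq_bigr (fun=> 2 ^+ N)); last first.
  move=> i _; rewrite exchange_big/= (bigD1 i)//= [X in _ + X]big1 ?addr0.
    under eq_bigr do rewrite -signr_addb addbb expr0.
    by rewrite sum_signs_const mulr1.
  by move=> j ji; rewrite sum_signs_indep// eq_sym.
by rewrite sumr_const card_ord mulr_natr.
Qed.

Lemma mean_abs_sum_signs_le :
  \sum_(s : {ffun 'I_N -> bool}) 2 ^- N * `|\sum_(i < N) (-1) ^+ s i|
    <= Num.sqrt N%:R :> R.
Proof.
(* The case [N = 0] goes first because the argument below divides by [q]. *)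
have [->|N0] := posnP N.
  by rewrite sqrtr0 big1// => s _; rewrite big_ord0 normr0 mulr0.
set q := Num.sqrt N%:R.
have q0 : 0 < q by rewrite sqrtr_gt0 ltr0n.
have q2 : q ^+ 2 = N%:R by rewrite sqr_sqrtr.
have p0 : 0 < 2 ^+ N :> R by rewrite exprn_gt0.
rewrite -mulr_sumr ler_pdivrMl//.
(* AM-GM: [2 q |x| <= x^2 + q^2], whose right-hand side averages to [2 q^2]. *)
have amgm (x : R) : `|x| <= (2 * q)^-1 * (x ^+ 2 + q ^+ 2).
  rewrite mulrC ler_pdivlMr ?mulr_gt0// -(real_normK (num_real x)).
  by have := sqr_ge0 (`|x| - q); nra.
apply: le_trans (ler_sum _ (fun s _ => amgm _)) _.
rewrite -mulr_sumr big_split/= sum_signs_sqr sum_signs_const -q2.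
by rewrite le_eqVlt; apply/orP; left; apply/eqP; field; lra.
Qed.

End signs.

(** * Symmetry and subadditivity of the Rademacher complexity *)

Section rademacher_theory.
Variables (R : realType) (T : Type) (N : nat) (Z : 'I_N -> T).
Implicit Types (g : T -> R) (G : set (T -> R)).

(** Negating [g] has the effect of flipping all signs at once, which only permutes the atoms. *)
Lemma rademacherN G : rademacher Z [set - g | g in G] = rademacher Z G.
Proof.
rewrite /rademacher -[RHS]ereal_sum_signsN; apply: eq_bigr => s _.
congr (_ * ereal_sup _)%E; rewrite image_comp; apply: eq_imagel => g _ /=.
by congr (_ * _)%:E; apply: eq_bigr => i _; rewrite ffunE signrN mulrN mulNr.
Qed.

(** This keeps the sum of two suprema away from the form [+oo - oo], so that the weights distribute
    over it. *)
Let signed_sup_Nye G (s : {ffun 'I_N -> bool}) : G !=set0 ->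
  (ereal_sup [set (N%:R^-1 * \sum_(i < N) (-1) ^+ s i * g (Z i))%R%:E
             | g in G] != -oo)%E.
Proof.
move=> [g Gg]; rewrite -ltNye; apply: lt_le_trans (ltNyr _) _.
by apply: ereal_sup_ubound; exists g.
Qed.

(** An inclusion suffices, and is all there is in the applications: there [g1] and [g2] share one
    parameter, whereas the full sumset mixes parameters. *)
Lemma rademacherD_le G0 G1 G2 : G1 !=set0 -> G2 !=set0 ->
  G0 `<=` [set g1 \+ g2 | g1 in G1 & g2 in G2] ->
  (rademacher Z G0 <= rademacher Z G1 + rademacher Z G2)%E.
Proof.
move=> G1n0 G2n0 G012; rewrite /rademacher -big_split/=.
apply: lee_sum => s _; rewrite -muleDr//; last first.
  by apply: ltninfty_adde_def; rewrite inE ltNye signed_sup_Nye.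
apply: lee_wpmul2l; first by rewrite lee_fin invr_ge0 exprn_ge0.
apply: ge_ereal_sup => _ [g G0g <-].
have [g1 G1g1 [g2 G2g2 <-]] := G012 _ G0g.
under eq_bigr do rewrite /= mulrDr.
rewrite big_split mulrDr EFinD.
by apply: leeD; apply: ereal_sup_ubound; [exists g1|exists g2].
Qed.

End rademacher_theory.

(** * Nonnegativity and subadditivity of the rates *)

Section rate_theory.
Variables (R : realType) (T : Type) (cost : T * T -> \bar R).
Hypothesis cost_diag : forall z, cost (z, z) = 0%E.
Variables (N : nat) (Z : 'I_N -> T).
Implicit Types (g h : T -> R) (G : set (T -> R)) (z : T) (t : R).

Lemma rate_ge0 g z t : 0 <= t -> (0 <= rate cost g z t)%E.
Proof.
move=> t0; apply: ereal_sup_ubound; exists z; last by rewrite subrr.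
by rewrite /= cost_diag lee_fin.
Qed.

Lemma rate_maxD_le g h t :
  (rate_max cost Z (g \+ h)%R t <= rate_max cost Z g t + rate_max cost Z h t)%E.
Proof.
apply/bigmax_leP; split => [|i _]; first exact: leNye.
apply: ge_ereal_sup => _ [z' cz' <-].
rewrite /= opprD addrACA EFinD.
by apply: leeD; apply: (le_trans _ (le_bigmax _ _ i)); apply: ereal_sup_ubound;
  exists z'.
Qed.

(** On an empty sample the maximum would be its default [-oo]. *)
Lemma rate_max_ge0 g t : (0 < N)%N -> 0 <= t -> (0 <= rate_max cost Z g t)%E.
Proof.
move=> N0 t0; apply: (le_trans _ (le_bigmax _ _ (Ordinal N0))).
exact: rate_ge0.
Qed.

End rate_theory.

(** * Subadditivity of the least concave majorant *)

Section concave_majorant_theory.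
Variable R : realType.
Implicit Types f H : R -> \bar R.

Lemma least_concave_majorant_ge f t : 0 <= t ->
  (f t <= least_concave_majorant f t)%E.
Proof. by move=> t0; apply: le_ereal_inf_tmp => _ [H [fH _] <-]; exact: fH. Qed.

Lemma concave_on_nnegD H1 H2 :
  (forall s, 0 <= s -> (0 <= H1 s)%E) -> (forall s, 0 <= s -> (0 <= H2 s)%E) ->
  concave_on_nneg H1 -> concave_on_nneg H2 ->
  concave_on_nneg (fun s => H1 s + H2 s)%E.
Proof.
move=> H1ge0 H2ge0 c1 c2.
(* The hypograph of the sum is the fibrewise Minkowski sum of hypographs. *)
have hypoD (s y : R) : 0 <= s -> (y%:E <= H1 s + H2 s)%E ->
    exists y1 y2 : R, [/\ (y1%:E <= H1 s)%E, (y2%:E <= H2 s)%E & y = y1 + y2].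
  move=> s0; move: (H1ge0 s s0) (H2ge0 s s0).
  (* Nonnegativity leaves finite values and [+oo]. One finite value is used up entirely and the
     other side takes the remainder of [y]. *)
  case: (H1 s) => [a||]//; case: (H2 s) => [b||]// a0 b0 yab.
  - by exists (y - b), b; rewrite !lee_fin lerBlDr subrK -lee_fin EFinD; split.
  - by exists a, (y - a); rewrite leey addrC subrK.
  - by exists (y - b), b; rewrite leey subrK.
  - by exists y, 0; rewrite !leey addr0.
move=> [x1 x2] [y1 y2] k; rewrite !inE => -[/= x10 /hypoD-/(_ x10)].
move=> [a1 [a2 [a1H a2H ->]]] [/= y10 /hypoD-/(_ y10)[b1 [b2 [b1H b2H ->]]]].
(* Both concavity hypotheses are used with the same abscissae and the same weight [k], so the two
   combinations lie over one point and their heights add. *)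
have /set_mem[/= k0 k1] := c1 (x1, a1) (y1, b1) k (mem_set (conj x10 a1H))
  (mem_set (conj y10 b1H)).
have /set_mem[/= _ k2] := c2 (x1, a2) (y1, b2) k (mem_set (conj x10 a2H))
  (mem_set (conj y10 b2H)).
split => //=; apply: le_trans (leeD k1 k2).
by rewrite -EFinD lee_fin !scalerDr addrACA.
Qed.

Lemma least_concave_majorantD_le f0 f1 f2 t : 0 <= t ->
  (forall s, 0 <= s -> (0 <= f1 s)%E) -> (forall s, 0 <= s -> (0 <= f2 s)%E) ->
  (forall s, 0 <= s -> (f0 s <= f1 s + f2 s)%E) ->
  (least_concave_majorant f0 t
     <= least_concave_majorant f1 t + least_concave_majorant f2 t)%E.
Proof.
move=> t0 f1ge0 f2ge0 f012.
have maj H1 H2 : concave_majorant f1 H1 -> concave_majorant f2 H2 ->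
    (least_concave_majorant f0 t <= H1 t + H2 t)%E.
  move=> [f1H c1] [f2H c2]; apply: ereal_inf_lbound.
  exists (fun s => H1 s + H2 s)%E => //; split => [s s0|].
    by apply: le_trans (f012 _ s0) _; apply: leeD; [exact: f1H|exact: f2H].
  by apply: concave_on_nnegD => // s s0;
    [exact: le_trans (f1ge0 _ s0) (f1H _ s0)
    |exact: le_trans (f2ge0 _ s0) (f2H _ s0)].
have C1ge0 := le_trans (f1ge0 _ t0) (least_concave_majorant_ge f1 t0).
have C2ge0 := le_trans (f2ge0 _ t0) (least_concave_majorant_ge f2 t0).
(* If one term is [+oo], then so is the right-hand side, the other term being nonnegative. *)
have [->|C1y] := eqVneq (least_concave_majorant f1 t) +oo%E.
  by rewrite addye ?leey// -ltNye (lt_le_trans _ C2ge0)// ltNy0.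
have [->|C2y] := eqVneq (least_concave_majorant f2 t) +oo%E.
  by rewrite addey ?leey// -ltNye (lt_le_trans _ C1ge0)// ltNy0.
(* The infima need not be attained: take majorants within [e / 2] of them at the point [t]. *)
apply/lee_addgt0Pr => e e0.
have e20 : 0 < e / 2 by rewrite divr_gt0.
have [|_ [H1 mH1 <-] H1e] := lb_ereal_inf_adherent e20
  (_ : least_concave_majorant f1 t \is a fin_num).
  by rewrite ge0_fin_numE// ltey.
have [|_ [H2 mH2 <-] H2e] := lb_ereal_inf_adherent e20
  (_ : least_concave_majorant f2 t \is a fin_num).
  by rewrite ge0_fin_numE// ltey.
apply: le_trans (maj _ _ mH1 mH2) _.
by rewrite [e]splitr EFinD addeACA; apply: leeD; exact: ltW.
Qed.

End concave_majorant_theory.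

(** * Nonnegativity and subadditivity of the concave complexity *)

Section concave_complexity_theory.
Variables (R : realType) (T : Type) (cost : T * T -> \bar R).
Hypothesis cost_diag : forall z, cost (z, z) = 0%E.
Variables (N : nat) (Z : 'I_N -> T).
Hypothesis N0 : (0 < N)%N.
Implicit Types (G : set (T -> R)) (t : R).

Lemma concave_complexity_ge0 G t : 0 <= t -> G !=set0 ->
  (0 <= concave_complexity cost Z G t)%E.
Proof.
move=> t0 [g Gg]; apply: le_ereal_sup_tmp.
exists (least_concave_majorant (rate_max cost Z g) t); first by exists g.
exact: le_trans (rate_max_ge0 cost_diag _ _ N0 t0)
  (least_concave_majorant_ge _ t0).
Qed.

Lemma concave_complexityD_le G0 G1 G2 t : 0 <= t ->
  G0 `<=` [set g1 \+ g2 | g1 in G1 & g2 in G2] ->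
  (concave_complexity cost Z G0 t
     <= concave_complexity cost Z G1 t + concave_complexity cost Z G2 t)%E.
Proof.
move=> t0 G012; apply: ge_ereal_sup => _ [g G0g <-].
have [g1 G1g1 [g2 G2g2 <-]] := G012 _ G0g.
apply: le_trans (least_concave_majorantD_le (f1 := rate_max cost Z g1)
  (f2 := rate_max cost Z g2) t0 _ _ _) _ => [s s0|s s0|s _|].
- exact: rate_max_ge0.
- exact: rate_max_ge0.
- exact: rate_maxD_le.
- by apply: leeD; apply: ereal_sup_ubound; [exists g1|exists g2].
Qed.

End concave_complexity_theory.

(** * The robust loss and the complexity of the rate class *)

Section loss_theory.
Variables (R : realType) (T Theta : Type) (cost : T * T -> \bar R).
Hypothesis cost_diag : forall z, cost (z, z) = 0%E.
Variables (l : T -> Theta -> R) (eps : R).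
Hypothesis eps_ge0 : 0 <= eps.
Hypothesis rate_fin : forall z theta, (rate cost (l^~ theta) z eps < +oo)%E.

Lemma rate_fineK z theta :
  (fine (rate cost (l^~ theta) z eps))%:E = rate cost (l^~ theta) z eps.
Proof. by rewrite fineK// ge0_fin_numE ?rate_fin ?rate_ge0. Qed.

Lemma robust_lossE z theta :
  robust_loss cost l eps z theta
    = l z theta + fine (rate cost (l^~ theta) z eps).
Proof.
rewrite /robust_loss; set S := ereal_sup _.
(* Identifying the supremum in [\bar R] before the cast also shows that it is finite. *)
suff -> : S = (l z theta + fine (rate cost (l^~ theta) z eps))%:E by [].
apply/eqP; rewrite eq_le; apply/andP; split.
  apply: ge_ereal_sup => _ [z' cz' <-].
  rewrite EFinD rate_fineK -leeBlDl// -EFinB.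
  by apply: ereal_sup_ubound; exists z'.
rewrite EFinD rate_fineK -leeBrDl//.
apply: ge_ereal_sup => _ [z' cz' <-].
by rewrite EFinB leeB//; apply: ereal_sup_ubound; exists z'.
Qed.

Lemma robust_class_sub :
  robust_class cost l eps
    `<=` [set g1 \+ g2 | g1 in loss_class l & g2 in rate_class cost l eps].
Proof.
move=> _ [theta _ <-]; exists (l^~ theta); first by exists theta.
exists (fun z => fine (rate cost (l^~ theta) z eps)); first by exists theta.
by apply/funext => z; rewrite robust_lossE.
Qed.

(** The decomposition of the robust loss, solved for the loss. Together with [rademacherN] it yields
    the other half of the absolute value bound. *)
Lemma loss_class_sub :
  loss_class l
    `<=` [set g1 \+ g2 | g1 in robust_class cost l eps
                       & g2 in [set - g | g in rate_class cost l eps]].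
Proof.
move=> _ [theta _ <-].
exists (fun z => robust_loss cost l eps z theta); first by exists theta.
exists (- (fun z => fine (rate cost (l^~ theta) z eps))).
  by exists (fun z => fine (rate cost (l^~ theta) z eps)) => //; exists theta.
by apply/funext => z; rewrite /= robust_lossE addrK.
Qed.

Variables (N : nat) (Z : 'I_N -> T).

(** Since rates are nonnegative, no sign pattern yields more than the one with all signs
    positive. *)
Lemma rademacher_rate_le_mean :
  (rademacher Z (rate_class cost l eps) <=
     ereal_sup (range (fun theta : Theta =>
       \sum_(i < N) (N%:R^-1)%R%:E * rate cost (l^~ theta) (Z i) eps)))%E.
Proof.
rewrite -[leRHS](ereal_mean_signs N) /rademacher.
apply: lee_sum => s _.
apply: lee_wpmul2l; first by rewrite lee_fin invr_ge0 exprn_ge0.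
apply: ge_ereal_sup => _ [_ [theta _ <-] <-].
apply: le_ereal_sup_tmp; eexists; first by exists theta.
under [leRHS]eq_bigr do rewrite -rate_fineK -EFinM.
rewrite sumEFin lee_fin -mulr_sumr; apply: ler_wpM2l; first by rewrite invr_ge0.
apply: ler_sum => i _; rewrite mulr_sign; case: (s i) => //.
by rewrite ge0_cp// fine_ge0// rate_ge0.
Qed.

Lemma rademacher_rate_le_sqrt : inhabited Theta -> (0 < N)%N ->
  (forall (i : 'I_N) (theta : Theta),
     rate cost (l^~ theta) (Z i) eps = rate_max cost Z (l^~ theta) eps) ->
  (rademacher Z (rate_class cost l eps) <=
     ((Num.sqrt N%:R)^-1)%R%:E *
     ereal_sup (range (fun theta : Theta => rate_max cost Z (l^~ theta) eps)))%E.
Proof.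
move=> [theta0] N0 rate_cst; set M := ereal_sup _.
have M_ge theta : (rate_max cost Z (l^~ theta) eps <= M)%E.
  by apply: ereal_sup_ubound; exists theta.
have M0 : (0 <= M)%E.
  by apply: le_trans (M_ge theta0); exact: rate_max_ge0.
pose S (s : {ffun 'I_N -> bool}) : R := \sum_(i < N) (-1) ^+ s i.
(* [S s] may be negative; passing to its absolute value first makes the bound monotone in the rate,
   which can then be raised to [M], possibly [+oo]. *)
have sup_le (s : {ffun 'I_N -> bool}) :
    (ereal_sup [set (N%:R^-1 * \sum_(i < N) (-1) ^+ s i * g (Z i))%R%:E
               | g in rate_class cost l eps] <= (N%:R^-1 * `|S s|)%:E * M)%E.
  apply: ge_ereal_sup => _ [_ [theta _ <-] <-].
  set m := fine (rate cost (l^~ theta) (Z (Ordinal N0)) eps).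
  have mE : m%:E = rate_max cost Z (l^~ theta) eps by rewrite rate_fineK.
  have m0 : 0 <= m by rewrite fine_ge0// rate_ge0.
  under eq_bigr do rewrite rate_cst -mE/=.
  rewrite -mulr_suml -/(S s).
  apply: (@le_trans _ _ ((N%:R^-1 * `|S s|)%:E * m%:E)%E).
    rewrite -EFinM lee_fin -mulrA ler_wpM2l ?invr_ge0// ler_wpM2r//.
    exact: ler_norm.
  by rewrite mE; apply: lee_wpmul2l => //; rewrite lee_fin mulr_ge0 ?invr_ge0.
have sum_le : (rademacher Z (rate_class cost l eps) <=
    \sum_(s : {ffun 'I_N -> bool}) (2 ^- N * (N%:R^-1 * `|S s|))%:E * M)%E.
  apply: lee_sum => s _; rewrite EFinM -muleA.
  by apply: lee_wpmul2l => //; rewrite lee_fin invr_ge0 exprn_ge0.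
apply: le_trans sum_le _.
rewrite -ge0_sume_distrl; last first.
  by move=> s _; rewrite lee_fin !mulr_ge0 ?invr_ge0 ?exprn_ge0.
apply: lee_wpmul2r => //; rewrite sumEFin lee_fin.
under eq_bigr do rewrite mulrCA.
rewrite -mulr_sumr ler_pdivrMl ?ltr0n//.
apply: le_trans (mean_abs_sum_signs_le R N) _.
(* Writing [N] as the square of its root turns [N / sqrt N] into [sqrt N]. *)
rewrite -{2}(@sqr_sqrtr R N%:R)// expr2 -mulrA mulfV ?mulr1//.
by rewrite gt_eqF// sqrtr_gt0 ltr0n.
Qed.

End loss_theory.

Theorem theorem2 (R : realType) (disp : measure_display)
  (T : measurableType disp) (Theta : Type) (hTheta : inhabited Theta)
  (cost : T * T -> \bar R) (mcost : measurable_fun [set: T * T] cost)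
  (cost_ge0 : forall p : T * T, (0 <= cost p)%E)
  (cost_diag : forall z : T, cost (z, z) = 0%E)
  (l : T -> Theta -> R)
  (N : nat) (hN : (0 < N)%N) (Z : 'I_N -> T)
  (eps : R) (heps : 0 < eps)
  (hfin : forall (z : T) (theta : Theta),
      (rate cost (l^~ theta) z eps < +oo)%E) :
  [/\ (rademacher Z (robust_class cost l eps) \is a fin_num ->
       rademacher Z (loss_class l) \is a fin_num ->
       (`|rademacher Z (robust_class cost l eps) - rademacher Z (loss_class l)|
          <= rademacher Z (rate_class cost l eps))%E),
      (rademacher Z (rate_class cost l eps) <=
         ereal_sup (range (fun theta : Theta =>
           \sum_(i < N) (N%:R^-1)%R%:E * rate cost (l^~ theta) (Z i) eps)))%E,
      ((forall (i : 'I_N) (theta : Theta),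
          rate cost (l^~ theta) (Z i) eps = rate_max cost Z (l^~ theta) eps) ->
       (rademacher Z (rate_class cost l eps) <=
          ((Num.sqrt N%:R)^-1)%R%:E *
          ereal_sup (range (fun theta : Theta =>
            rate_max cost Z (l^~ theta) eps)))%E) &
      (forall t : R, 0 < t ->
         (0 <= concave_complexity cost Z (robust_class cost l eps) t)%E /\
         (concave_complexity cost Z (robust_class cost l eps) t <=
            concave_complexity cost Z (loss_class l) t +
            concave_complexity cost Z (rate_class cost l eps) t)%E)].
Proof.
have [theta0] := hTheta.
have eps0 := ltW heps.
have Ln0 : loss_class l !=set0 by exists (l^~ theta0); exists theta0.
have Rn0 : robust_class cost l eps !=set0.
  by exists ((robust_loss cost l eps)^~ theta0); exists theta0.
have Yn0 : rate_class cost l eps !=set0.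
  by exists (fun z => fine (rate cost (l^~ theta0) z eps)); exists theta0.
split.
- have RLY := rademacherD_le Z Ln0 Yn0 (robust_class_sub cost_diag eps0 hfin).
  have NYn0 : [set - g | g in rate_class cost l eps] !=set0.
    by have [g Yg] := Yn0; exists (- g); exists g.
  have := rademacherD_le Z Rn0 NYn0 (loss_class_sub cost_diag eps0 hfin).
  rewrite rademacherN; move: RLY.
  (* The first two complexities are real by assumption. For the third, [-oo] contradicts [RLY],
     [+oo] is trivial, and a real value leaves linear arithmetic. *)
  case: (rademacher Z (robust_class cost l eps)) => // a.
  case: (rademacher Z (loss_class l)) => // b.
  case: (rademacher Z (rate_class cost l eps)) => [c| |//] ab ba _ _.
    move: ab ba; rewrite -!EFinD !lee_fin => ab ba.
    by rewrite ler_norml; apply/andP; split; lra.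
  by rewrite leey.
- exact: rademacher_rate_le_mean.
- exact: rademacher_rate_le_sqrt.
- move=> t /ltW t0; split; first exact: concave_complexity_ge0.
  exact: concave_complexityD_le (robust_class_sub cost_diag eps0 hfin).
Qed.
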